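(* Let $T$ be an unbounded selfadjoint operator in $H$. Then \[ W_e(T)=\operatorname{conv}\big(\widehat\sigma_e(T)\big)\setminus\{\pm\infty\}. \]
   Context: $H$ is a separable infinite-dimensional complex Hilbert space. $W_e(T)=\{\lambda\in\mathbb C:\exists x_n\in\operatorname{dom}(T),\|x_n\|=1,x_n\stackrel{w}{\to}0,\langle Tx_n,x_n\rangle\to\lambda\}$. $\sigma_e(T)=\{\lambda:\exists x_n\in\operatorname{dom}(T),\|x_n\|=1,x_n\stackrel{w}{\to}0,\|(T-\lambda)x_n\|\to0\}$. For selfadjoint $T$, the extended essential spectrum $\widehat\sigma_e(T)\subset\mathbb R\cup\{+\infty,-\infty\}$ is $\sigma_e(T)$ with $+\infty$ added if $T$ is unbounded from above and $-\infty$ added if $T$ is unbounded from below; the convex hull is taken in the extended real line $\mathbb R\cup\{\pm\infty\}$. *)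

(* Defs.v *)
From HB Require Import structures.
From mathcomp Require Import all_boot all_order all_algebra.
From mathcomp Require Import all_classical all_reals all_analysis.
From mathcomp Require Import complex.
Set Implicit Arguments. Unset Strict Implicit. Unset Printing Implicit Defensive.
Import Order.TTheory GRing.Theory Num.Theory.
Import numFieldNormedType.Exports.
Local Open Scope classical_set_scope.
Local Open Scope ring_scope.

Section Hilbert.
Variable R : realType.
Local Notation C := (R[i]).
Variable H : lmodType C.
Variable ip : H -> H -> C.

Definition inner_product_axioms : Prop :=
  [/\ (forall (a : C) (x y z : H), ip (a *: x + y) z = a * ip x z + ip y z),
      (forall x y : H, ip y x = conjc (ip x y)),
      (forall x : H, 0 <= ip x x) &
      (forall x : H, ip x x = 0 -> x = 0)].

Definition hnorm (x : H) : R := Num.sqrt (complex.Re (ip x x)).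

Definition ccvg (u : nat -> C) (l : C) : Prop :=
  (fun n => complex.Re (u n)) @ \oo --> (complex.Re l : R) /\ (fun n => complex.Im (u n)) @ \oo --> (complex.Im l : R).

Definition hcomplete : Prop :=
  forall u : nat -> H,
    (forall e : R, 0 < e -> exists N : nat, forall m n : nat,
        (N <= m)%N -> (N <= n)%N -> hnorm (u m - u n) < e) ->
    exists x : H, (fun n => hnorm (u n - x)) @ \oo --> (0 : R).

Definition hseparable : Prop :=
  exists d : nat -> H, forall (x : H) (e : R), 0 < e ->
    exists n : nat, hnorm (x - d n) < e.

Definition hinfinite_dim : Prop :=
  forall n : nat, exists v : 'I_n -> H,
    forall i j : 'I_n, ip (v i) (v j) = (i == j)%:R.

Definition separable_inf_hilbert : Prop :=
  [/\ inner_product_axioms, hcomplete, hseparable & hinfinite_dim].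

(* An operator in H: a linear map T defined on the linear subspace D = dom(T)
   (the values of T outside D are irrelevant). *)
Definition lin_operator (D : set H) (T : H -> H) : Prop :=
  D 0 /\ forall (a : C) (x y : H), D x -> D y ->
    D (a *: x + y) /\ T (a *: x + y) = a *: T x + T y.

Definition densely_defined (D : set H) : Prop :=
  forall (x : H) (e : R), 0 < e -> exists y, D y /\ hnorm (x - y) < e.

Definition adjoint_domain (D : set H) (T : H -> H) : set H :=
  [set y | exists z : H, forall x, D x -> ip (T x) y = ip x z].

Definition selfadjoint (D : set H) (T : H -> H) : Prop :=
  [/\ lin_operator D T, densely_defined D,
      (forall x y, D x -> D y -> ip (T x) y = ip x (T y)) &
      adjoint_domain D T `<=` D].

Definition bounded_op (D : set H) (T : H -> H) : Prop :=
  exists M : R, forall x, D x -> hnorm (T x) <= M * hnorm x.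

Definition unbounded_op (D : set H) (T : H -> H) : Prop := ~ bounded_op D T.

Definition bounded_above (D : set H) (T : H -> H) : Prop :=
  exists M : R, forall x, D x -> hnorm x = 1 -> complex.Re (ip (T x) x) <= M.

Definition bounded_below (D : set H) (T : H -> H) : Prop :=
  exists M : R, forall x, D x -> hnorm x = 1 -> M <= complex.Re (ip (T x) x).

Definition weak_to0 (x : nat -> H) : Prop :=
  forall y : H, ccvg (fun n => ip (x n) y) 0.

Definition ess_numrange (D : set H) (T : H -> H) : set C :=
  [set l | exists x : nat -> H,
     [/\ forall n, D (x n), forall n, hnorm (x n) = 1, weak_to0 x &
         ccvg (fun n => ip (T (x n)) (x n)) l]].

Definition ess_spectrum (D : set H) (T : H -> H) : set C :=
  [set l | exists x : nat -> H,
     [/\ forall n, D (x n), forall n, hnorm (x n) = 1, weak_to0 x &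
         (fun n => hnorm (T (x n) - l *: x n)) @ \oo --> (0 : R)]].

Definition ext_ess_spectrum (D : set H) (T : H -> H) : set (\bar R) :=
  [set y | (exists r : R, y = r%:E /\ ess_spectrum D T (r%:C)%C)
           \/ (y = +oo%E /\ ~ bounded_above D T)
           \/ (y = -oo%E /\ ~ bounded_below D T)].

End Hilbert.

Definition econvex (R : realType) (S : set (\bar R)) : Prop :=
  forall x y z : \bar R, S x -> S y -> (x <= z)%E -> (z <= y)%E -> S z.

Definition econv (R : realType) (S : set (\bar R)) : set (\bar R) :=
  [set z | forall K : set (\bar R), econvex K -> S `<=` K -> K z].

(* Main.v *)
Require Import Defs.
From HB Require Import structures.
From mathcomp Require Import all_boot all_order all_algebra.
From mathcomp Require Import all_classical all_reals all_analysis.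
From mathcomp Require Import complex ring lra.
Set Implicit Arguments. Unset Strict Implicit. Unset Printing Implicit Defensive.
Import Order.TTheory GRing.Theory Num.Theory.
Import numFieldNormedType.Exports.
Local Open Scope classical_set_scope.
Local Open Scope ring_scope.

(** The real part of the inner product makes H a real Hilbert space in which T
is still selfadjoint, and by separability weakly null sequences can be replaced
by unit vectors almost orthogonal to finitely many given vectors.

If l lies in W_e(T) and T is bounded below, choose c below T and put
B = (T - c)^-1. Cauchy-Schwarz for the form of B gives
<Bx, x> >= 1 / <(T - c)x, x> for unit x, so the largest point M of W_e(B) is at
least 1 / (l - c). This M belongs to sigma_e(B), hence c + 1/M <= l belongs to
sigma_e(T). Applying this to -T as well puts l in the convex hull.

Conversely W_e(T) contains sigma_e(T) and is convex, and if T is unbounded above,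
adding to each vector of a weakly null sequence a small multiple of a vector of
very large energy raises the limit of <Tx, x> by any prescribed amount. *)

(** * Real inner product spaces *)

Definition real_ip (R : realType) (V : lmodType R) (b : V -> V -> R) : Prop :=
  [/\ forall (a : R) (x y z : V), b (a *: x + y) z = a * b x z + b y z,
      forall x y : V, b y x = b x y,
      forall x : V, 0 <= b x x &
      forall x : V, b x x = 0 -> x = 0].

Section RealInnerProduct.
Variables (R : realType) (V : lmodType R) (b : V -> V -> R).
Hypothesis ipb : real_ip b.

Lemma ipC x y : b x y = b y x.
Proof. by case: ipb. Qed.

Lemma ip_ge0 x : 0 <= b x x.
Proof. by case: ipb. Qed.

Lemma ip_eq0 x : b x x = 0 -> x = 0.
Proof. by case: ipb => _ _ _; apply. Qed.

Lemma ipDl x y z : b (x + y) z = b x z + b y z.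
Proof. by case: ipb => lin _ _ _; rewrite -[x in LHS]scale1r lin mul1r. Qed.

Lemma ip0l z : b 0 z = 0.
Proof. by have := ipDl 0 0 z; rewrite addr0 => /eqP; rewrite -subr_eq subrr => /eqP <-. Qed.

Lemma ipZl a x z : b (a *: x) z = a * b x z.
Proof. by case: ipb => lin _ _ _; rewrite -[_ *: _]addr0 lin ip0l addr0. Qed.

Lemma ipNl x z : b (- x) z = - b x z.
Proof. by rewrite -scaleN1r ipZl mulN1r. Qed.

Lemma ipDr x y z : b z (x + y) = b z x + b z y.
Proof. by rewrite ipC ipDl !(ipC z). Qed.

Lemma ip0r z : b z 0 = 0. Proof. by rewrite ipC ip0l. Qed.

Lemma ipZr a x z : b z (a *: x) = a * b z x.
Proof. by rewrite ipC ipZl (ipC z). Qed.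

Lemma ipNr x z : b z (- x) = - b z x.
Proof. by rewrite ipC ipNl (ipC z). Qed.

Definition ipE := (ipDl, ipDr, ipZl, ipZr, ipNl, ipNr, ip0l, ip0r).

Definition ipnorm x : R := Num.sqrt (b x x).
Local Notation N := ipnorm.

Lemma ipnorm_ge0 x : 0 <= N x. Proof. exact: sqrtr_ge0. Qed.

Lemma ipnormK x : N x ^+ 2 = b x x.
Proof. by rewrite sqr_sqrtr ?ip_ge0. Qed.

Lemma ip_unit x : N x = 1 -> b x x = 1.
Proof. by rewrite -ipnormK => ->; rewrite expr1n. Qed.

Lemma ipnormZ a x : N (a *: x) = `|a| * N x.
Proof.
by rewrite /N ipZl ipZr mulrA -expr2 sqrtrM ?sqr_ge0// sqrtr_sqr.
Qed.

Lemma ipnormN x : N (- x) = N x.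
Proof. by rewrite /N ipNl ipNr opprK. Qed.

Lemma ipnormB x y : N (x - y) = N (y - x).
Proof. by rewrite -ipnormN opprB. Qed.

Lemma le_ipnorm x a : 0 <= a -> (N x <= a) = (b x x <= a ^+ 2).
Proof. by move=> a0; rewrite -ipnormK ler_pXn2r// nnegrE ipnorm_ge0. Qed.

Lemma lt_ipnorm x a : 0 <= a -> (N x < a) = (b x x < a ^+ 2).
Proof. by move=> a0; rewrite -ipnormK ltr_pXn2r// nnegrE ipnorm_ge0. Qed.

Lemma cauchy_schwarz x y : `|b x y| <= N x * N y.
Proof.
rewrite -(@ler_pXn2r _ 2)// ?nnegrE ?mulr_ge0 ?ipnorm_ge0//.
rewrite real_normK ?num_real// exprMn !ipnormK.
have [yy0|yy0] := eqVneq (b y y) 0.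
  by rewrite (ip_eq0 yy0) !ipE mulr0 expr0n.
have ygt : 0 < b y y by rewrite lt_neqAle eq_sym yy0 ip_ge0.
have := ip_ge0 (b y y *: x - b x y *: y).
rewrite !ipE (ipC y x) => h.
have : 0 <= b y y * (b x x * b y y - b x y ^+ 2) by rewrite (le_trans h)//; lra.
by rewrite pmulr_rge0// subr_ge0.
Qed.

Lemma ipnormD x y : N (x + y) <= N x + N y.
Proof.
rewrite le_ipnorm ?addr_ge0 ?ipnorm_ge0// !ipE (ipC y x) sqrrD !ipnormK.
have := ler_norm (b x y); have := cauchy_schwarz x y; lra.
Qed.

Lemma ipnorm_sub x y : N x <= N (x - y) + N y.
Proof. by rewrite -[x in leLHS](subrK y) ipnormD. Qed.

Lemma ipnorm_unitZ x : N x != 0 -> N ((N x)^-1 *: x) = 1.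
Proof. by move=> x0; rewrite ipnormZ ger0_norm ?invr_ge0 ?ipnorm_ge0// mulVf. Qed.

End RealInnerProduct.

(** * Selfadjoint operators *)

Lemma harmonic_small (R : realType) (e : R) : 0 < e ->
  exists n0, forall n, (n0 <= n)%N -> n.+1%:R^-1 < e.
Proof.
move=> e0; exists (Num.trunc e^-1) => n hn.
rewrite invf_plt ?posrE// (lt_le_trans (truncnS_gt _))// ler_nat ltnS.
exact: hn.
Qed.

Section RealOperators.
Variables (R : realType) (V : lmodType R) (b : V -> V -> R).
Local Notation N := (ipnorm b).

Definition dense_domain (D : set V) : Prop :=
  forall x e, 0 < e -> exists2 y, D y & N (x - y) < e.

Definition rsymmetric (D : set V) (T : V -> V) : Prop :=
  [/\ D 0,
      forall (a : R) x y, D x -> D y -> D (a *: x + y),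
      forall (a : R) x y, D x -> D y -> T (a *: x + y) = a *: T x + T y &
      forall x y, D x -> D y -> b (T x) y = b x (T y)].

(** The last clause puts the domain of the adjoint inside [D]; [z] is the value of the adjoint at
    [y]. *)
Definition rselfadjoint (D : set V) (T : V -> V) : Prop :=
  [/\ rsymmetric D T, dense_domain D &
      forall y z, (forall x, D x -> b (T x) y = b x z) -> D y].

Definition rcomplete : Prop := forall u : nat -> V,
  (forall e, 0 < e -> exists n0, forall m n,
     (n0 <= m)%N -> (n0 <= n)%N -> N (u m - u n) < e) ->
  exists x, forall e, 0 < e -> exists n0, forall n, (n0 <= n)%N -> N (u n - x) < e.

Hypothesis ipb : real_ip b.
Local Notation ipE := (ipE ipb).

(** If [g] were nonzero, a [y] in [D] closer to [g] than [N g] would give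
    [N g ^+ 2 = b (g - y) g < N g ^+ 2]. *)
Lemma ip_dense0 D g : dense_domain D -> (forall x, D x -> b x g = 0) -> g = 0.
Proof.
move=> dD hg; apply: (ip_eq0 ipb); apply/eqP; rewrite -ipnormK// sqrf_eq0.
apply/negP => /negP g0; have gN : 0 < N g by rewrite lt_neqAle eq_sym g0 ipnorm_ge0.
have [y Dy hy] := dD g _ gN.
have := cauchy_schwarz ipb (g - y) g; rewrite !ipE (hg _ Dy) subr0 -ipnormK//.
by rewrite ger0_norm ?sqr_ge0// expr2 ler_pM2r// leNgt hy.
Qed.

Section Symmetric.
Variables (D : set V) (T : V -> V).
Hypothesis symT : rsymmetric D T.

Lemma domZ a x : D x -> D (a *: x).
Proof. by case: symT => D0 DD _ _ Dx; rewrite -[_ *: _]addr0; apply: DD. Qed.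

Lemma domD x y : D x -> D y -> D (x + y).
Proof. by case: symT => D0 DD _ _ Dx Dy; rewrite -[x]scale1r; apply: DD. Qed.

Lemma domB x y : D x -> D y -> D (x - y).
Proof. by move=> Dx Dy; apply: domD => //; rewrite -scaleN1r; apply: domZ. Qed.

Lemma opD x y : D x -> D y -> T (x + y) = T x + T y.
Proof. by case: symT => _ _ TD _ Dx Dy; rewrite -[x in LHS]scale1r TD// scale1r. Qed.

Lemma op0 : T 0 = 0.
Proof.
case: symT => D0 _ _ _; have := opD D0 D0.
by rewrite addr0 => /eqP; rewrite -subr_eq subrr => /eqP <-.
Qed.

Lemma opZ a x : D x -> T (a *: x) = a *: T x.
Proof. by case: symT => D0 _ TD _ Dx; rewrite -[_ *: _]addr0 TD// op0 addr0. Qed.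

Lemma opB x y : D x -> D y -> T (x - y) = T x - T y.
Proof.
move=> Dx Dy; have DNy : D (-1 *: y) by exact: domZ.
by rewrite -scaleN1r opD// opZ// scaleN1r.
Qed.

Lemma op_sym x y : D x -> D y -> b (T x) y = b x (T y).
Proof. by case: symT => _ _ _; apply. Qed.

Lemma symmetric_shift c : rsymmetric D (fun x => T x - c *: x).
Proof.
case: symT => D0 DD TD TS; split => // [a x y Dx Dy|x y Dx Dy].
  by rewrite TD// !scalerDr scalerN !scalerA (mulrC c) opprD addrACA.
by rewrite !ipE TS.
Qed.

Lemma symmetric_opp : rsymmetric D (fun x => - T x).
Proof.
case: symT => D0 DD TD TS; split => // [a x y Dx Dy|x y Dx Dy].
  by rewrite TD// opprD scalerN.
by rewrite !ipE TS.
Qed.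

End Symmetric.

Lemma selfadjoint_shift D T c :
  rselfadjoint D T -> rselfadjoint D (fun x => T x - c *: x).
Proof.
case=> symT dD adj; split => //; first exact: symmetric_shift.
move=> y z h; apply: (adj y (z + c *: y)) => x Dx.
by have := h x Dx; rewrite !ipE => /eqP; rewrite subr_eq => /eqP.
Qed.

Lemma selfadjoint_opp D T : rselfadjoint D T -> rselfadjoint D (fun x => - T x).
Proof.
case=> symT dD adj; split => //; first exact: symmetric_opp.
move=> y z h; apply: (adj y (- z)) => x Dx.
by have := h x Dx; rewrite !ipE => <-; rewrite opprK.
Qed.

(** Adjoints are closed: the limit of [b (T v) (u n) = b v (T (u n))] puts [x] in the adjoint
    domain, hence in [D], and density of [D] then forces [T x = w]. *)
Lemma selfadjoint_closed D T (u : nat -> V) x w : rselfadjoint D T ->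
  (forall n, D (u n)) ->
  (forall e, 0 < e -> exists n0, forall n, (n0 <= n)%N -> N (u n - x) < e) ->
  (forall e, 0 < e -> exists n0, forall n, (n0 <= n)%N -> N (T (u n) - w) < e) ->
  D x /\ T x = w.
Proof.
move=> [symT dD adj] Du ux Tuw.
have Txw v : D v -> b (T v) x = b v w.
  move=> Dv; apply/eqP; rewrite -subr_eq0 -normr_le0; apply/ler_addgt0Pr => e e0.
  have k0 : 0 < N (T v) + N v + 1.
    by rewrite ltr_wpDl// addr_ge0// ipnorm_ge0.
  have ek0 : 0 < e / (N (T v) + N v + 1) by rewrite divr_gt0.
  have [n1 h1] := ux _ ek0; have [n2 h2] := Tuw _ ek0.
  have := h1 _ (leq_maxl n1 n2); have := h2 _ (leq_maxr n1 n2).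
  move: ek0; set n := maxn n1 n2; set d := e / _ => d0 hw hx.
  have -> : b (T v) x - b v w = b v (T (u n) - w) - b (T v) (u n - x).
    by rewrite !ipE (op_sym symT Dv (Du n)); ring.
  have de : d * (N (T v) + N v + 1) = e by rewrite divfK// gt_eqF.
  rewrite add0r (le_trans (ler_normB _ _))//.
  have c1 := cauchy_schwarz ipb v (T (u n) - w).
  have c2 := cauchy_schwarz ipb (T v) (u n - x).
  have c3 := ler_wpM2l (ipnorm_ge0 b v) (ltW hw).
  have c4 := ler_wpM2l (ipnorm_ge0 b (T v)) (ltW hx).
  lra.
have Dx : D x by exact: adj Txw.
split=> //; apply/eqP; rewrite -subr_eq0; apply/eqP/(ip_dense0 dD) => v Dv.
by rewrite !ipE -(op_sym symT Dv Dx) Txw// subrr.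
Qed.

(** * Invertibility of coercive selfadjoint operators *)

Section Coercive.
Variables (D : set V) (S : V -> V).
Hypothesis saS : rselfadjoint D S.
Hypothesis coercive : forall x, D x -> b x x <= b (S x) x.

Let symS : rsymmetric D S. Proof. by case: saS. Qed.

Lemma coercive_le_norm x : D x -> N x <= N (S x).
Proof.
move=> Dx; have := le_trans (coercive Dx) (le_trans (ler_norm _) (cauchy_schwarz ipb _ _)).
rewrite -ipnormK// expr2; have [->|x0] := eqVneq (N x) 0; first by rewrite ipnorm_ge0.
by rewrite ler_pM2r// lt_neqAle eq_sym x0 ipnorm_ge0.
Qed.

(* Least squares: a minimizing sequence for |S u - y| is Cauchy by the
   parallelogram law, and the residual of its limit is orthogonal to the range
   of S, hence lies in the kernel of the adjoint of S, which is trivial. *)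
Lemma coercive_surjective : rcomplete -> forall y, exists x, D x /\ S x = y.
Proof.
move=> compl y.
pose E := [set b (S u - y) (S u - y) | u in D].
have D0 : D 0 by case: symS.
have infE : has_inf E.
  by split; [exists (b (S 0 - y) (S 0 - y)), 0|exists 0 => _ [u _ <-]; exact: ip_ge0].
set d := inf E.
have dE u : D u -> d <= b (S u - y) (S u - y).
  by move=> Du; apply: (ge_inf infE.2); exists u.
have d0 : 0 <= d by apply: (lb_le_inf infE.1) => _ [u _ <-]; exact: ip_ge0.
have apx n : exists u, D u /\ b (S u - y) (S u - y) < d + n.+1%:R^-1.
  have n0 : 0 < n.+1%:R^-1 :> R by rewrite invr_gt0.
  by have [_ [u Du <-] h] := inf_adherent n0 infE; exists u.
have [u hu] := choice apx.
have Du n : D (u n) by case: (hu n).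
have Dm m n : D (u m - u n) by exact: (domB symS).
(* The residual at the midpoint has square norm at least [d], which cancels the two [d] in the
   bounds on [u m] and [u n]. *)
have para m n : b (S (u m - u n)) (S (u m - u n)) <= 2 * (m.+1%:R^-1 + n.+1%:R^-1).
  have DD : D (u m + u n) by exact: (domD symS).
  have := dE _ (domZ symS 2^-1 DD); have := (hu m).2; have := (hu n).2.
  rewrite (opZ symS)// (opD symS)// (opB symS)//.
  rewrite !ipE (ipC ipb (S (u n)) (S (u m))).
  rewrite (ipC ipb y (S (u m))) (ipC ipb y (S (u n))).
  by move: (m.+1%:R^-1) (n.+1%:R^-1) => p q; lra.
have cau e : 0 < e -> exists n0, forall m n, (n0 <= m)%N -> (n0 <= n)%N ->
    N (S (u m - u n)) < e.
  move=> e0; have e20 : 0 < e ^+ 2 / 4 by rewrite divr_gt0// exprn_gt0.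
  have [n0 h0] := harmonic_small e20; exists n0 => m n hm hn.
  rewrite lt_ipnorm ?ltW// (le_lt_trans (para m n))//.
  by have := h0 _ hm; have := h0 _ hn; move: (m.+1%:R^-1) (n.+1%:R^-1) => p q; lra.
have [x hx] : exists x, forall e, 0 < e ->
    exists n0, forall n, (n0 <= n)%N -> N (u n - x) < e.
  apply: compl => e /cau[n0 h]; exists n0 => m n hm hn.
  by rewrite (le_lt_trans (coercive_le_norm (Dm _ _)))// h.
have [w hw] : exists w, forall e, 0 < e ->
    exists n0, forall n, (n0 <= n)%N -> N (S (u n) - w) < e.
  apply: (compl (S \o u)) => e /cau[n0 h]; exists n0 => m n hm hn /=.
  by rewrite -(opB symS)// h.
have [Dx Sx] := selfadjoint_closed saS Du hx hw.
have min : b (S x - y) (S x - y) <= d.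
  rewrite -(sqr_sqrtr d0) -le_ipnorm ?sqrtr_ge0//; apply/ler_addgt0Pr => e e0.
  have e2 : 0 < e / 2 by rewrite divr_gt0.
  have [n0 h0] := hw _ e2; have [n1 h1] := harmonic_small (exprn_gt0 2 e2).
  have hn0 := h0 _ (leq_maxl n0 n1); have hn1 := h1 _ (leq_maxr n0 n1).
  move: hn0 hn1; set n := maxn n0 n1 => hn0 hn1.
  have : N (S (u n) - y) <= Num.sqrt d + e / 2.
    rewrite le_ipnorm ?addr_ge0 ?sqrtr_ge0 ?ltW// sqrrD sqr_sqrtr//.
    have := (hu n).2; have := mulr_ge0 (sqrtr_ge0 d) (ltW e2).
    by rewrite mulr2n; move: (n.+1%:R^-1) ((e / 2) ^+ 2) (_ * _) hn1 => p q r; lra.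
  have := ipnormD ipb (S x - S (u n)) (S (u n) - y).
  rewrite addrA subrK (ipnormB ipb (S x) (S (u n))) Sx; lra.
have [g gE] : exists g, g = S x - y by exists (S x - y).
rewrite -gE in min.
have orth v : D v -> b (S v) g = 0.
  move=> Dv; set be := b (S v) g; set s := b (S v) (S v).
  have s0 : 0 <= s by exact: ip_ge0.
  have s1 : 0 < s + 1 by rewrite ltr_wpDl.
  (* First variation in the direction [v]. Dividing by [s + 1] instead of [s] covers [S v = 0];
     minimality then forces [t = 0], so [be = 0]. *)
  set t := - be / (s + 1).
  have te : t * (s + 1) = - be by rewrite divfK// gt_eqF.
  have Dxv : D (x + t *: v) by apply/(domD symS) => //; exact: (domZ symS).
  have := dE _ Dxv.
  rewrite (opD symS)// ?(opZ symS)//; last exact: (domZ symS).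
  have -> : S x + t *: S v - y = g + t *: S v by rewrite gE addrAC.
  rewrite !ipE (ipC ipb g (S v)) -/be -/s => h.
  have h' : 0 <= 2 * t * be + t ^+ 2 * s by lra.
  have bE : be = - (t * (s + 1)) by rewrite te opprK.
  have t0 : t ^+ 2 = 0.
    apply/eqP; rewrite eq_le sqr_ge0 andbT.
    have := mulr_ge0 (sqr_ge0 t) s0; move: h'; rewrite bE; lra.
  by move/eqP: t0; rewrite sqrf_eq0 bE => /eqP ->; rewrite mul0r oppr0.
have Dg : D g by case: saS => _ _ adj; apply: (adj g 0) => v Dv; rewrite orth// ip0r.
exists x; split=> //; apply/eqP; rewrite -subr_eq0 -gE; apply/eqP/(ip_eq0 ipb).
by apply/le_anti; rewrite ip_ge0// (le_trans (coercive Dg))// orth.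
Qed.

End Coercive.
End RealOperators.

(** * Essential numerical range *)

Section LocalCharacterizations.
Variables (R : realType) (V : lmodType R) (b : V -> V -> R).
Local Notation N := (ipnorm b).

Definition weakly_small (F : seq V) (e : R) (x : V) : Prop :=
  forall y, y \in F -> `|b x y| < e.

(** Sequence-free form of the essential numerical range at a real point. As [F] is arbitrary, each
    new vector can be made almost orthogonal to vectors chosen earlier. *)
Definition local_numrange (D : set V) (T : V -> V) (r : R) : Prop :=
  forall F (e : R), 0 < e ->
    exists x, [/\ D x, N x = 1, weakly_small F e x & `|b (T x) x - r| < e].

Definition local_spectrum (D : set V) (T : V -> V) (r : R) : Prop :=
  forall F (e : R), 0 < e ->
    exists x, [/\ D x, N x = 1, weakly_small F e x & N (T x - r *: x) < e].

Hypothesis ipb : real_ip b.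
Local Notation ipE := (ipE ipb).

Lemma weakly_smallW F e e' x : e <= e' -> weakly_small F e x -> weakly_small F e' x.
Proof. by move=> ee h y /h /lt_le_trans; apply. Qed.

Lemma weakly_small_near F e : 0 < e -> exists2 d, 0 < d & forall x z,
  weakly_small F d x -> N (z - x) < d -> weakly_small F e z.
Proof.
move=> e0; set K := \sum_(y <- F) N y.
have K0 : 0 <= K by apply: sumr_ge0 => y _; exact: ipnorm_ge0.
have K1 : 0 < 1 + K by rewrite ltr_pwDl.
have leK y : y \in F -> N y <= K.
  move=> yF; rewrite /K (big_rem y)//= lerDl.
  by apply: sumr_ge0 => w _; exact: ipnorm_ge0.
(* With this [d], [|b z y| <= |b x y| + N (z - x) * N y < d + d * K = e]. *)
exists (e / (1 + K)); first exact: divr_gt0.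
set d := e / _ => x z hx hz y yF.
have dK : d * (1 + K) = e by rewrite divfK// gt_eqF.
have d0 : 0 < d by rewrite divr_gt0.
have -> : b z y = b x y + b (z - x) y by rewrite !ipE; ring.
rewrite (le_lt_trans (ler_normD _ _))//.
have h1 := hx _ yF; have h2 := cauchy_schwarz ipb (z - x) y.
have h3 := ler_pM (ipnorm_ge0 _ _) (ipnorm_ge0 _ _) (ltW hz) (leK _ yF).
lra.
Qed.

Lemma ipnorm_dist x z : `|N z - N x| <= N (z - x).
Proof.
have := ipnorm_sub ipb z x; have := ipnorm_sub ipb x z.
by rewrite (ipnormB ipb x) ler_norml; lra.
Qed.

Section Symmetric.
Variables (D : set V) (T : V -> V).
Hypothesis symT : rsymmetric b D T.

Lemma local_spectrum_numrange r :
  local_spectrum D T r -> local_numrange D T r.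
Proof.
move=> h F e e0; have [x [Dx x1 xF hx]] := h F e e0; exists x; split => //.
have -> : b (T x) x - r = b (T x - r *: x) x by rewrite !ipE (ip_unit ipb x1) mulr1.
by rewrite (le_lt_trans (cauchy_schwarz ipb _ _))// x1 mulr1.
Qed.

(** Normalizing divides the form by [N x ^+ 2], which is close to 1, so later constructions need not
    produce exact unit vectors. *)
Lemma local_numrange_almost_unit r :
  (forall F (e : R), 0 < e -> exists x, [/\ D x, `|N x - 1| < e,
     weakly_small F e x & `|b (T x) x - r| < e]) -> local_numrange D T r.
Proof.
move=> h F e e0.
have r0 : 0 <= `|r| by exact: normr_ge0.
have k0 : 0 < 5 * (1 + 3 * `|r|) by lra.
(* The bound [2^-1] gives [n ^+ 2 >= 4^-1] and [|n ^+ 2 - 1| <= 3 * d]. The error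
   [d * (1 + 3 * |r|)] must stay below [e * n ^+ 2], and 5 exceeds the resulting factor 4. *)
set d := Num.min 2^-1 (e / (5 * (1 + 3 * `|r|))).
have d0 : 0 < d by rewrite lt_min invr_gt0 ltr0n divr_gt0.
have d12 : d <= 2^-1 by rewrite ge_min lexx.
have dk : d * (5 * (1 + 3 * `|r|)) <= e.
  by rewrite -ler_pdivlMr// ge_min lexx orbT.
have [x [Dx x1 xF hx]] := h F d d0.
set n := N x in x1; have [n1 n2] : 1 - d < n /\ n < 1 + d.
  by move: x1; rewrite ltr_norml; lra.
have n0 : 0 < n by lra.
have n0' : n != 0 by rewrite gt_eqF.
exists (n^-1 *: x); split; first exact: (domZ symT).
- exact: ipnorm_unitZ.
- move=> y yF; rewrite (ipZl ipb) normrM normfV (gtr0_norm n0) mulrC ltr_pdivrMr//.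
  have := xF y yF; have : 0 <= d * `|r| by rewrite mulr_ge0// ltW.
  have : e * (1 - n) <= e * 2^-1 by rewrite ler_pM2l//; lra.
  lra.
- rewrite (opZ symT)// !ipE.
  have -> : n^-1 * (n^-1 * b (T x) x) - r = (b (T x) x - r * n ^+ 2) / n ^+ 2.
    by field.
  rewrite normrM normfV (gtr0_norm (exprn_gt0 2 n0)) ltr_pdivrMr ?exprn_gt0//.
  have -> : b (T x) x - r * n ^+ 2 = (b (T x) x - r) - r * (n ^+ 2 - 1) by ring.
  rewrite (le_lt_trans (ler_normB _ _))// normrM.
  have n3 : `|n ^+ 2 - 1| <= 3 * d by rewrite ler_norml; apply/andP; split; nra.
  have n4 : 4^-1 <= n ^+ 2 by nra.
  have := ler_wpM2l r0 n3; have : e * 4^-1 <= e * n ^+ 2 by rewrite ler_pM2l.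
  have := mulr_ge0 (ltW d0) r0; lra.
Qed.

(** A small change in norm preserves weak smallness and almost unit length, while it may change the
    energy at will. The unperturbed [x] may lie outside [D]. *)
Lemma local_numrange_perturb r :
  (forall F (e : R), 0 < e -> exists x z, [/\ N x = 1, weakly_small F e x, D z,
     N (z - x) < e & `|b (T z) z - r| < e]) -> local_numrange D T r.
Proof.
move=> h; apply: local_numrange_almost_unit => F e e0.
have [d d0 hd] := weakly_small_near F e0.
have m0 : 0 < Num.min d e by rewrite lt_min d0.
have md : Num.min d e <= d by rewrite ge_min lexx.
have me : Num.min d e <= e by rewrite ge_min lexx orbT.
have [x [z [x1 xF Dz zx hz]]] := h F _ m0; exists z; split => //.
- by rewrite -x1; exact: le_lt_trans (ipnorm_dist _ _) (lt_le_trans zx me).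
- by apply: hd (weakly_smallW md xF) _; exact: lt_le_trans md.
- exact: lt_le_trans me.
Qed.

(** If [y] is almost orthogonal to both [x] and [T x], the cross terms in the norm and in the form
    of [p *: x + q *: y] are negligible. With [p ^+ 2 = s] and [q ^+ 2 = t] the form is then close
    to [s * a + t * c]. *)
Lemma local_numrange_convex a c r : local_numrange D T a ->
  local_numrange D T c -> a <= r -> r <= c -> local_numrange D T r.
Proof.
move=> ha hc ar rc; have [ac|ac] := eqVneq a c.
  by have -> : r = a by apply/le_anti; rewrite ar ac rc.
have ca : 0 < c - a by rewrite subr_gt0 lt_neqAle ac (le_trans ar).
set s := (c - r) / (c - a); set t := (r - a) / (c - a).
have s0 : 0 <= s by apply: divr_ge0; [rewrite subr_ge0|exact: ltW].
have t0 : 0 <= t by apply: divr_ge0; [rewrite subr_ge0|exact: ltW].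
have st : s + t = 1 by rewrite /s /t; field; rewrite gt_eqF.
have -> : r = s * a + t * c by rewrite /s /t; field; rewrite gt_eqF.
apply: local_numrange_almost_unit => F e e0.
have e4 : 0 < e / 4 by rewrite divr_gt0.
have [x [Dx x1 xF hx]] := ha F _ e4.
have [y [Dy y1 yF hy]] := hc [:: x, T x & F] _ e4.
have yx : `|b x y| < e / 4 by rewrite (ipC ipb) yF// inE eqxx.
have yTx : `|b (T x) y| < e / 4 by rewrite (ipC ipb) yF// !inE eqxx orbT.
set p := Num.sqrt s; set q := Num.sqrt t.
have pp : p ^+ 2 = s by rewrite sqr_sqrtr.
have qq : q ^+ 2 = t by rewrite sqr_sqrtr.
have p0 : 0 <= p by exact: sqrtr_ge0.
have q0 : 0 <= q by exact: sqrtr_ge0.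
have p1 : p <= 1 by rewrite -(@ler_pXn2r _ 2)// ?nnegrE// expr1n pp; lra.
have q1 : q <= 1 by rewrite -(@ler_pXn2r _ 2)// ?nnegrE// expr1n qq; lra.
have pq0 : 0 <= p * q by exact: mulr_ge0.
have pq1 : p * q <= 1 by exact: mulr_ile1.
exists (p *: x + q *: y); split.
- by apply/(domD symT); exact: (domZ symT).
- set z := p *: x + _.
  have zz : N z ^+ 2 = 1 + 2 * (p * q * b x y).
    rewrite (ipnormK ipb) !ipE (ip_unit ipb x1) (ip_unit ipb y1) (ipC ipb y x).
    transitivity (p ^+ 2 + q ^+ 2 + 2 * (p * q * b x y)); first by ring.
    by rewrite pp qq st.
  have zd : `|N z ^+ 2 - 1| <= e / 2.
    rewrite zz addrAC subrr add0r normrM normr_nat normrM (ger0_norm pq0).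
    have := ler_pM pq0 (normr_ge0 _) pq1 (ltW yx); lra.
  rewrite (@le_lt_trans _ _ (e / 2))//; last by lra.
  (* Since [N z + 1 >= 1], [|N z - 1|] is at most [|N z ^+ 2 - 1|]. *)
  have zN : N z ^+ 2 - 1 = (N z - 1) * (N z + 1) by ring.
  apply: le_trans zd; rewrite zN normrM.
  by rewrite ler_peMr// ger0_norm ?addr_ge0 ?ipnorm_ge0// lerDr ipnorm_ge0.
- move=> f fF; rewrite !ipE (le_lt_trans (ler_normD _ _))// !normrM (ger0_norm p0) (ger0_norm q0).
  have fy : `|b y f| < e / 4 by rewrite yF// !inE fF !orbT.
  have := ler_pM p0 (normr_ge0 _) p1 (ltW (xF f fF)).
  have := ler_pM q0 (normr_ge0 _) q1 (ltW fy); lra.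
- rewrite (opD symT) ?(opZ symT)//; try exact: (domZ symT).
  have -> : b (p *: T x + q *: T y) (p *: x + q *: y) - (s * a + t * c) =
      s * (b (T x) x - a) + t * (b (T y) y - c) + 2 * (p * q * b (T x) y).
    by rewrite !ipE (op_sym symT Dy Dx) (ipC ipb y) -pp -qq; ring.
  rewrite (le_lt_trans (ler_normD _ _))//.
  have h1 := ler_normD (s * (b (T x) x - a)) (t * (b (T y) y - c)).
  rewrite (normrM s) (normrM t) (ger0_norm s0) (ger0_norm t0) in h1.
  rewrite [X in _ + X < _]normrM normrM (ger0_norm pq0) normr_nat.
  have h2 := ler_pM pq0 (normr_ge0 _) pq1 (ltW yTx).
  have h3 := ler_wpM2l s0 (ltW hx); have h4 := ler_wpM2l t0 (ltW hy).
  have h5 : s * (e / 4) + t * (e / 4) = e / 4 by rewrite -mulrDl st mul1r.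
  lra.
Qed.

(* The added vector t u is small in norm but carries energy t^2 <Tu,u> = h. *)
Lemma raise_form x h e : (forall K, exists u, [/\ D u, N u = 1 & K < b (T u) u]) ->
  D x -> 0 <= h -> 0 < e ->
  exists z, [/\ D z, N (z - x) < e & `|b (T z) z - (b (T x) x + h)| < e].
Proof.
move=> unb Dx h0 e0.
have n0 : 0 <= N (T x) by exact: ipnorm_ge0.
have n1 : 0 < 2 * (1 + N (T x)) by lra.
(* For [t <= d], both the norm of [t *: u] and the cross term [2 * t * b (T x) u] are below [e]. *)
set d := e / (2 * (1 + N (T x))).
have d0 : 0 < d by rewrite divr_gt0.
have dn : d * (2 * (1 + N (T x))) = e by rewrite divfK// gt_eqF.
have dn0 : 0 <= d * N (T x) by rewrite mulr_ge0// ltW.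
(* This energy level makes [h / k < d ^+ 2], hence [t <= d]. *)
have [u [Du u1 hu]] := unb ((h + 1) / d ^+ 2).
set k := b (T u) u in hu.
have dd : 0 < d ^+ 2 by rewrite exprn_gt0.
have k0 : 0 < k by rewrite (le_lt_trans _ hu)// divr_ge0// ?ltW//; lra.
have dk : h + 1 < k * d ^+ 2 by rewrite -ltr_pdivrMr.
set t := Num.sqrt (h / k).
have t0 : 0 <= t by exact: sqrtr_ge0.
have tt : t ^+ 2 = h / k by rewrite sqr_sqrtr// divr_ge0// ltW.
have tk : t ^+ 2 * k = h by rewrite tt divfK// gt_eqF.
have td : t <= d.
  rewrite -(@ler_pXn2r _ 2)// ?nnegrE ?(ltW d0)// tt ler_pdivrMr//; lra.
exists (x + t *: u); split.
- by apply/(domD symT) => //; exact: (domZ symT).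
- rewrite addrAC subrr add0r (ipnormZ ipb) u1 mulr1 ger0_norm//; lra.
- rewrite (opD symT)// ?(opZ symT)//; last exact: (domZ symT).
  have -> : b (T x + t *: T u) (x + t *: u) - (b (T x) x + h) = 2 * (t * b (T x) u).
    by rewrite !ipE (op_sym symT Du Dx) (ipC ipb u) -/k -tk; ring.
  rewrite normrM normr_nat normrM (ger0_norm t0).
  have h1 := cauchy_schwarz ipb (T x) u; rewrite u1 mulr1 in h1.
  have := ler_pM t0 (normr_ge0 _) td h1; lra.
Qed.

Lemma local_numrange_up a r : (forall K, exists u, [/\ D u, N u = 1 & K < b (T u) u]) ->
  local_numrange D T a -> a <= r -> local_numrange D T r.
Proof.
move=> unb ha ar; apply: local_numrange_perturb => F e e0.
have e2 : 0 < e / 2 by rewrite divr_gt0.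
have [x [Dx x1 xF hx]] := ha F _ e2.
have ra : 0 <= r - a by rewrite subr_ge0.
have [z [Dz zx hz]] := raise_form unb Dx ra e2.
exists x, z; split => //; first by apply: weakly_smallW xF; lra.
- by apply: lt_trans zx _; lra.
- have -> : b (T z) z - r = b (T z) z - (b (T x) x + (r - a)) + (b (T x) x - a) by ring.
  by rewrite (le_lt_trans (ler_normD _ _))//; lra.
Qed.

End Symmetric.

Lemma local_numrange_opp D T r :
  local_numrange D (fun x => - T x) r <-> local_numrange D T (- r).
Proof.
split=> h F e e0; have [x [Dx x1 xF hx]] := h F e e0; exists x; split => //.
  by rewrite -normrN opprD -(ipNl ipb) opprK.
by rewrite (ipNl ipb) -normrN opprD opprK.
Qed.

Lemma local_spectrum_opp D T r :
  local_spectrum D (fun x => - T x) r <-> local_spectrum D T (- r).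
Proof.
split=> h F e e0; have [x [Dx x1 xF hx]] := h F e e0; exists x; split => //.
  by rewrite -(ipnormN ipb) opprD scaleNr opprK.
by rewrite -(ipnormN ipb) opprD opprK -scaleNr.
Qed.

(** * Infinite dimension and operators unbounded on both sides *)

Definition rinfinite_dim : Prop :=
  forall n, exists v : 'I_n -> V, forall i j, b (v i) (v j) = (i == j)%:R.

(** With one more orthonormal vector than there are conditions, the matrix of inner products has a
    nonzero left kernel vector [c]. Its entries are the coordinates of the required vector before
    normalization. *)
Lemma orthogonal_unit (F : seq V) : rinfinite_dim ->
  exists2 x, N x = 1 & forall y, y \in F -> b x y = 0.
Proof.
move=> /(_ (size F).+1)[v vv].
pose M := \matrix_(i < (size F).+1, j < size F) b (v i) F`_j.
have kM : kermx M != 0.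
  by rewrite -mxrank_eq0 mxrank_ker subn_eq0 -ltnNge ltnS rank_leq_col.
have /rowV0Pn[c /sub_kermxP cM c0] := kM.
pose x := \sum_i c 0 i *: v i.
have bx y : b x y = \sum_i c 0 i * b (v i) y.
  rewrite /x; elim/big_rec2: _ => [|i p q _ <-]; first exact: ip0l.
  by rewrite !ipE.
have bv i : b x (v i) = c 0 i.
  rewrite bx (bigD1 i)//= vv eqxx mulr1 big1 ?addr0// => j ji.
  by rewrite vv (negPf ji) mulr0.
have x0 : N x != 0.
  apply/eqP => x0; have {}x0 : x = 0 by apply: (ip_eq0 ipb); rewrite -ipnormK// x0 expr0n.
  move/eqP: c0; apply; apply/rowP => i; rewrite -bv x0 mxE; exact: ip0l.
exists ((N x)^-1 *: x) => [|y yF]; first exact: ipnorm_unitZ.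
have yi : (index y F < size F)%N by rewrite index_mem.
move/rowP: cM => /(_ (Ordinal yi)); rewrite !mxE => cM.
rewrite (ipZl ipb) bx -[RHS](mulr0 (N x)^-1) -[in RHS]cM; congr (_ * _).
by apply: eq_bigr => i _; rewrite mxE /= nth_index.
Qed.

(** No point of the essential numerical range is needed to start: a domain vector near a unit vector
    orthogonal to [F] has its energy moved to [r], upwards by [T] or downwards by [- T]. *)
Lemma local_numrange_unbounded D T r : rinfinite_dim -> dense_domain b D ->
  rsymmetric b D T ->
  (forall K, exists u, [/\ D u, N u = 1 & K < b (T u) u]) ->
  (forall K, exists u, [/\ D u, N u = 1 & b (T u) u < K]) ->
  local_numrange D T r.
Proof.
move=> inf dD symT up low; apply: (local_numrange_perturb symT) => F e e0.
have e2 : 0 < e / 2 by rewrite divr_gt0.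
have [x x1 xF] := orthogonal_unit F inf.
have [y Dy xy] := dD x _ e2; rewrite (ipnormB ipb) in xy.
suff [z [Dz zy hz]] : exists z, [/\ D z, N (z - y) < e / 2 & `|b (T z) z - r| < e / 2].
  exists x, z; split => //.
  - by move=> f fF; rewrite xF// normr0.
  - have := ipnormD ipb (z - y) (y - x); rewrite addrA subrK; lra.
  - lra.
have [yr|/ltW yr] := leP (b (T y) y) r.
  have [|z [Dz zy hz]] := raise_form symT up Dy (h := r - b (T y) y) _ e2.
    by rewrite subr_ge0.
  by exists z; split => //; move: hz; rewrite addrCA subrr addr0.
have low' K : exists u, [/\ D u, N u = 1 & K < b (- T u) u].
  by have [u [Du u1 hu]] := low (- K); exists u; split; rewrite // ipNl// ltrNr.
have [|z [Dz zy hz]] := raise_form (symmetric_opp ipb symT) low' Dy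
    (h := b (T y) y - r) _ e2.
  by rewrite subr_ge0.
exists z; split => //; move: hz; rewrite !(ipNl ipb) addrA addNr add0r opprK.
by rewrite -normrN opprD !opprK.
Qed.

End LocalCharacterizations.

(** * The bottom of the essential spectrum *)

Section BottomOfSpectrum.
Variables (R : realType) (V : lmodType R) (b : V -> V -> R).
Local Notation N := (ipnorm b).
Hypothesis ipb : real_ip b.
Local Notation ipE := (ipE ipb).

(* M is the top of the essential numerical range of B. For weakly small x,
   <B^3 x, x> <= (M + eta) |Bx|^2; inserting this into <B(Bx - Mx), Bx - Mx> >= 0
   bounds |Bx|^2 by about M <Bx, x>, so |Bx - Mx|^2 is about M (M - <Bx, x>). *)
Lemma top_essential_spectrum (B : V -> V) (p : R) :
  (forall a x y, B (a *: x + y) = a *: B x + B y) ->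
  (forall x y, b (B x) y = b x (B y)) ->
  (forall x, 0 <= b (B x) x) -> (forall x, N (B x) <= N x) -> 0 < p ->
  (forall F (e : R), 0 < e ->
     exists x, [/\ N x = 1, weakly_small b F e x & p - e < b (B x) x]) ->
  exists2 M, p <= M & forall F (e : R), 0 < e ->
     exists x, [/\ N x = 1, weakly_small b F e x & N (B x - M *: x) < e].
Proof.
move=> Blin Bsym Bpos Bcontr p0 hp.
(* The supremum of [P] is the top of the essential numerical range of [B]. *)
pose P := [set s : R | forall F (e : R), 0 < e ->
     exists x, [/\ N x = 1, weakly_small b F e x & s - e < b (B x) x]].
have B1 x : N x = 1 -> b (B x) (B x) <= 1.
  by move=> x1; rewrite -(expr1n R 2) -le_ipnorm// -x1.
have B1' x : N x = 1 -> b (B x) x <= 1.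
  move=> x1; rewrite (le_trans (ler_norm _))// (le_trans (cauchy_schwarz ipb _ _))//.
  by rewrite x1 mulr1 -x1.
have Pub s : P s -> s <= 1.
  move=> Ps; apply/ler_addgt0Pr => e e0; have [x [x1 _ hx]] := Ps [::] e e0.
  have := B1' x x1; lra.
have supP : has_sup P by split; [exists p|exists 1 => s; exact: Pub].
pose M := sup P.
have pM : p <= M by apply: (sup_upper_bound supP).
have M0 : 0 < M by exact: lt_le_trans pM.
have M1 : M <= 1 by apply: sup_le_ub => [|s]; [exists p|exact: Pub].
exists M => // F e e0.
have e2 : 0 < e ^+ 2 * M / 4 by rewrite divr_gt0// mulr_gt0// exprn_gt0.
set eta := e ^+ 2 * M / 4 in e2.
have : ~ P (M + eta).
  by move=> /(sup_upper_bound supP); rewrite -/M gerDl leNgt e2.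
move=> /existsNP[F' /existsNP[e' /not_implyP[e'0 hF']]].
(* Since [M + eta] fails to lie in [P], some [F'] and [e'] exclude unit vectors of larger form;
   scaling extends the bound to all nonzero [z]. *)
have top z : weakly_small b F' (e' * N z) z -> N z != 0 ->
    b (B z) z <= (M + eta) * N z ^+ 2.
  move=> zF z0; have zp : 0 < N z by rewrite lt_neqAle eq_sym z0 ipnorm_ge0.
  rewrite leNgt; apply/negP => hz; apply: hF'.
  exists ((N z)^-1 *: z); split; first exact: ipnorm_unitZ.
    move=> y yF; rewrite (ipZl ipb) normrM normfV (gtr0_norm zp) mulrC.
    by rewrite ltr_pdivrMr// zF.
  have -> : B ((N z)^-1 *: z) = (N z)^-1 *: B z.
    have B0 : B 0 = 0.
      have := Blin 1 0 0; rewrite scaler0 addr0 scale1r => /eqP.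
      by rewrite -subr_eq subrr => /eqP <-.
    by rewrite -[_ *: z]addr0 Blin B0 addr0.
  rewrite !ipE mulrA -invfM -expr2 mulrC ltr_pdivlMr ?exprn_gt0//.
  apply: lt_trans hz; rewrite ltr_pM2r ?exprn_gt0//; lra.
set mu := Num.min eta (M / 2).
have mu0 : 0 < mu by rewrite lt_min e2 divr_gt0.
have mu1 : mu <= eta by rewrite ge_min lexx.
have mu2 : mu <= M / 2 by rewrite ge_min lexx orbT.
(* The three bounds serve the weak smallness of [x], the gap [M - b (B x) x], and the weak smallness
   of [B x] relative to its norm, which is at least [M / 2]. *)
set d := Num.min (Num.min e mu) (e' * (M / 2)).
have d0 : 0 < d by rewrite lt_min mulr_gt0 ?divr_gt0// lt_min e0 mu0.
have dm : d <= Num.min e mu by rewrite ge_min lexx.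
have de : d <= e by rewrite (le_trans dm)// ge_min lexx.
have dmu : d <= mu by rewrite (le_trans dm)// ge_min lexx orbT.
have de' : d <= e' * (M / 2) by rewrite ge_min lexx orbT.
(* By symmetry of [B], smallness of [x] against [map B F'] is smallness of [B x] against [F'], so
   [top] will apply to [B x]. *)
have PM : exists x, [/\ N x = 1, weakly_small b (map B F' ++ F) d x & M - d < b (B x) x].
  have d2 : 0 < d / 2 by rewrite divr_gt0.
  have [s Ps hs] := sup_adherent d2 supP.
  have [x [x1 xF hx]] := Ps (map B F' ++ F) _ d2; exists x; split => //.
    by apply: weakly_smallW xF; lra.
  rewrite -/M in hs; lra.
have [x [x1 xF hx]] := PM; exists x; split => //.
  by move=> y yF; apply: lt_le_trans de; apply: xF; rewrite mem_cat yF orbT.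
have NB : M / 2 <= N (B x).
  have := cauchy_schwarz ipb (B x) x; have := ler_norm (b (B x) x); rewrite x1; lra.
have NB0 : N (B x) != 0 by rewrite gt_eqF// (lt_le_trans _ NB)// divr_gt0.
have t3 : b (B (B x)) (B x) <= (M + eta) * b (B x) (B x).
  rewrite -(ipnormK ipb) top// => y yF; rewrite Bsym.
  apply: (@lt_le_trans _ _ d); first by apply: xF; rewrite mem_cat map_f.
  by rewrite (le_trans de')// ler_pM2l.
have pos : 0 <= b (B (B x)) (B x) - 2 * M * b (B x) (B x) + M ^+ 2 * b (B x) x.
  have := Bpos ((- M) *: x + B x); rewrite Blin !ipE (Bsym (B x) x); lra.
rewrite lt_ipnorm ?ltW// !ipE (ip_unit ipb x1) (ipC ipb x (B x)) mulr1.
have a2 := B1 _ x1; have a20 := ip_ge0 ipb (B x).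
move: (b (B x) (B x)) (b (B (B x)) (B x)) (b (B x) x) t3 pos hx a2 a20.
move=> q c a t3 pos hx a2 a20.
have M2 : 0 <= M ^+ 2 by exact: sqr_ge0.
have hq : eta * q <= eta by rewrite ler_piMr// ltW.
have ha : M ^+ 2 * (M - a) <= M ^+ 2 * mu by apply: ler_wpM2l => //; lra.
have hmu : M ^+ 2 * mu <= mu.
  by apply: ler_piMl; [exact: ltW|apply: exprn_ile1 => //; exact: ltW].
have h4 : M * (e ^+ 2 / 2) = 2 * eta by rewrite /eta; field.
(* By [t3] and [pos], [M * q <= eta * q + M ^+ 2 * a]. So [M] times the left side is at most
   [eta + M ^+ 2 * (M - a) <= 2 * eta], half of [M * e ^+ 2]. *)
rewrite -(ltr_pM2l M0).
have : 0 < M * e ^+ 2 by rewrite mulr_gt0// exprn_gt0.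
lra.
Qed.

(** The shift by [c = m - 1] gives [S >= 1], whose inverse [B] is a positive contraction; inversion
    exchanges the bottom for [S] with the top for [B]. *)
Lemma bottom_essential_spectrum D T m r : rcomplete b -> rselfadjoint b D T ->
  (forall x, D x -> N x = 1 -> m <= b (T x) x) -> local_numrange b D T r ->
  exists2 s, s <= r & local_spectrum b D T s.
Proof.
move=> compl saT low hr; pose c := m - 1.
have [S saS SE] : exists2 S, rselfadjoint b D S & forall x, S x = T x - c *: x.
  by exists (fun x => T x - c *: x) => //; exact: selfadjoint_shift.
have [symT dD _] := saT; have [symS _ _] := saS.
have coer x : D x -> b x x <= b (S x) x.
  move=> Dx; have [x0|x0] := eqVneq (N x) 0.
    have -> : x = 0 by apply: (ip_eq0 ipb); rewrite -(ipnormK ipb) x0 expr0n.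
    by rewrite (op0 symS) !ipE.
  have xp : 0 < N x by rewrite lt_neqAle eq_sym x0 ipnorm_ge0.
  have := low _ (domZ symT (N x)^-1 Dx) (ipnorm_unitZ ipb x0).
  rewrite (opZ symT)// SE !ipE mulrA -invfM -expr2 mulrC ler_pdivlMr ?exprn_gt0//.
  by rewrite (ipnormK ipb) /c; lra.
have [B hB] := choice (coercive_surjective ipb saS coer compl).
have DB y : D (B y) by case: (hB y).
have SB y : S (B y) = y by case: (hB y).
have Sinj x y : D x -> D y -> S x = S y -> x = y.
  move=> Dx Dy Sxy; have Dxy : D (x - y) by exact: (domB symS).
  apply/eqP; rewrite -subr_eq0; apply/eqP/(ip_eq0 ipb)/le_anti.
  by rewrite ip_ge0// (le_trans (coer _ Dxy))// (opB symS)// Sxy subrr ip0l.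
have BS x : D x -> B (S x) = x by move=> Dx; apply: Sinj.
have Blin a x y : B (a *: x + y) = a *: B x + B y.
  apply: Sinj => //; first by case: symS => _ DD _ _; exact: DD.
  by rewrite SB; case: symS => _ _ SD _; rewrite SD// !SB.
have Bsym x y : b (B x) y = b x (B y).
  by rewrite -[y in LHS]SB -(op_sym symS)// SB.
have Bpos x : 0 <= b (B x) x.
  by rewrite (ipC ipb) -{1}(SB x); exact: le_trans (ip_ge0 ipb _) (coer _ _).
have p1 x : D x -> N x = 1 -> 1 <= b (S x) x.
  by move=> Dx x1; rewrite -(ip_unit ipb x1) coer.
have hrS F (e : R) : 0 < e -> exists x,
    [/\ D x, N x = 1, weakly_small b F e x & `|b (S x) x - (r - c)| < e].
  move=> e0; have [x [Dx x1 xF hx]] := hr F e e0; exists x; split => //.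
  have -> // : b (S x) x - (r - c) = b (T x) x - r.
  by rewrite SE !ipE (ip_unit ipb x1); ring.
set p := r - c in hrS.
have p_ge1 : 1 <= p.
  apply/ler_addgt0Pr => e e0; have [x [Dx x1 _ hx]] := hrS [::] e e0.
  have := p1 x Dx x1; move: hx; rewrite ltr_norml; lra.
have p_gt0 : 0 < p by lra.
have [] := @top_essential_spectrum B p^-1.
- exact: Blin.
- exact: Bsym.
- exact: Bpos.
- by move=> x; rewrite -[x in leRHS]SB (coercive_le_norm ipb coer).
- by rewrite invr_gt0.
- move=> F e e0; have [x [Dx x1 xF hx]] := hrS F e e0; exists x; split => //.
  have q1 := p1 x Dx x1; set q := b (S x) x in q1 hx.
  have q0 : 0 < q by lra.
  (* The form of [B] at [S x - q *: x] equals this product. Its positivity is the Cauchy-Schwarz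
     bound [b (B x) x >= 1 / q]. *)
  have : 0 <= q * (q * b (B x) x - 1).
    have := Bpos ((- q) *: x + S x).
    by rewrite Blin (BS _ Dx) !ipE (Bsym x (S x)) BS// (ipC ipb x) -/q (ip_unit ipb x1); lra.
  rewrite pmulr_rge0// subr_ge0 => h.
  (* After multiplication by [p * q], the claim follows from [q < p + e], [p * q >= 1] and
     [q * b (B x) x >= 1]. *)
  rewrite -(ltr_pM2l (mulr_gt0 p_gt0 q0)).
  have -> : p * q * (p^-1 - e) = q - e * (p * q) by field; rewrite gt_eqF.
  have := ler_wpM2l (ltW p_gt0) h; have : 1 <= p * q by exact: mulr_ege1.
  move=> /(ler_wpM2l (ltW e0)); have := ltr_normlW hx; lra.
move=> M pM hM; have M0 : 0 < M by rewrite (lt_le_trans _ pM)// invr_gt0.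
exists (c + M^-1).
  have : M^-1 <= p by rewrite -[p]invrK lef_pV2 ?posrE ?invr_gt0.
  by rewrite /p; lra.
move=> F e e0.
(* The approximate eigenvector is [B x] divided by its norm [n]. The three bounds give [n >= M / 2],
   its weak smallness, and a residual [N (B x - M *: x) / (n * M)] below [e]. *)
set d := Num.min (M / 2) (Num.min (e * M / 2) (e * M ^+ 2 / 2)).
have d0 : 0 < d by rewrite !lt_min !divr_gt0 ?mulr_gt0 ?exprn_gt0.
have [d1 d2 d3] : [/\ d <= M / 2, d <= e * M / 2 & d <= e * M ^+ 2 / 2].
  by rewrite /d !ge_min !lexx ?orbT.
have [x [x1 xF hx]] := hM (map B F) d d0.
set n := N (B x).
have nM : M / 2 <= n.
  have := ipnorm_sub ipb (M *: x) (B x).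
  by rewrite (ipnormZ ipb) x1 (gtr0_norm M0) mulr1 (ipnormB ipb) -/n; lra.
have n0 : 0 < n by rewrite (lt_le_trans _ nM)// divr_gt0.
exists (n^-1 *: B x); split.
- exact: (domZ symT).
- by apply: ipnorm_unitZ => //; rewrite gt_eqF.
- move=> y yF; rewrite (ipZl ipb) normrM normfV (gtr0_norm n0) mulrC ltr_pdivrMr//.
  rewrite Bsym (lt_le_trans (xF _ (map_f B yF)))// (le_trans d2)// -mulrA.
  by rewrite ler_pM2l.
- have -> : T (n^-1 *: B x) - (c + M^-1) *: (n^-1 *: B x) =
      (- (n^-1 * M^-1)) *: (B x - M *: x).
    have TB : T (B x) = x + c *: B x by rewrite -{2}(SB x) SE subrK.
    rewrite (opZ symT)// TB scalerDr scalerBr !scalerA -addrA -scalerBl.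
    rewrite addrC -[in RHS]scaleNr.
    congr (_ *: _ + _ *: _); first by ring.
    by field; rewrite !gt_eqF.
  rewrite (ipnormZ ipb) normrN gtr0_norm ?mulr_gt0 ?invr_gt0// -invfM mulrC.
  rewrite ltr_pdivrMr ?mulr_gt0// (lt_le_trans hx)// (le_trans d3)//.
  by rewrite -mulrA ler_pM2l// expr2 -mulrA mulrC -mulrA [n * M]mulrC ler_pM2l// mulrC.
Qed.

End BottomOfSpectrum.

(** * Reduction to the real Hilbert space *)

Lemma cvgn_dist (R : realType) (f : nat -> R) (l : R) : f @ \oo --> l <->
  forall e, 0 < e -> exists n0, forall n, (n0 <= n)%N -> `|f n - l| < e.
Proof.
split=> [/cvgrPdist_lt h e e0|h].
  by have [n0 _ hn0] := h e e0; exists n0 => n hn; rewrite distrC; exact: hn0.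
apply/cvgrPdist_lt => e e0; have [n0 hn0] := h e e0.
by exists n0 => // n hn; rewrite distrC; exact: hn0.
Qed.

(** * From weak neighbourhoods of zero to weakly null sequences *)

Section WeakSequences.
Variables (R : realType) (V : lmodType R) (b : V -> V -> R).
Local Notation N := (ipnorm b).
Hypothesis ipb : real_ip b.

Lemma weakly_small_eventually (u : nat -> V) :
  (forall y, (fun n => b (u n) y) @ \oo --> (0 : R)) ->
  forall F (e : R), 0 < e ->
    exists n0, forall n, (n0 <= n)%N -> weakly_small b F e (u n).
Proof.
move=> hu F e e0; elim: F => [|y F [n0 hn0]]; first by exists 0%N.
have [n1 hn1] := (cvgn_dist _ _).1 (hu y) e e0.
exists (maxn n0 n1) => n; rewrite geq_max => /andP[/hn0 h0 /hn1 h1] z.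
by rewrite inE => /predU1P[->|/h0//]; rewrite -[b _ _]subr0.
Qed.

(** The [n]-th vector is tested against [d 0], ..., [d n] only. Unit length and density of [d]
    extend the convergence to every [y]. *)
Lemma weakly_small_sequence (Q : R -> V -> Prop) :
  (exists d : nat -> V, forall x e, 0 < e -> exists n, N (x - d n) < e) ->
  (forall F (e : R), 0 < e -> exists x, [/\ N x = 1, weakly_small b F e x & Q e x]) ->
  exists u : nat -> V, [/\ forall n, N (u n) = 1, forall n, Q n.+1%:R^-1 (u n) &
    forall y, (fun n => b (u n) y) @ \oo --> (0 : R)].
Proof.
move=> [d dd] h.
have apx n : exists x, [/\ N x = 1,
    weakly_small b [seq d i | i <- iota 0 n.+1] n.+1%:R^-1 x & Q n.+1%:R^-1 x].
  by apply: h; rewrite invr_gt0.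
have [u hu] := choice apx.
exists u; split=> [n|n|y]; try by case: (hu n).
apply/cvgn_dist => e e0; have e2 : 0 < e / 2 by rewrite divr_gt0.
have [i hi] := dd y _ e2; have [n0 hn0] := harmonic_small e2.
exists (maxn i n0) => n; rewrite geq_max => /andP[ni /hn0 nn].
have [u1 /(_ (d i)) uF _] := hu n.
have -> : b (u n) y - 0 = b (u n) (y - d i) + b (u n) (d i).
  by rewrite subr0 !(ipE ipb) subrK.
have h1 := cauchy_schwarz ipb (u n) (y - d i); rewrite u1 mul1r in h1.
have h2 : `|b (u n) (d i)| < n.+1%:R^-1.
  by apply: uF; apply: map_f; rewrite mem_iota.
rewrite (le_lt_trans (ler_normD _ _))//; move: (n.+1%:R^-1) nn h2 => q; lra.
Qed.

End WeakSequences.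

(** A synonym of [H], so that the real scalar action can be declared beside the complex one. *)
Definition realification (R : realType) (H : lmodType R[i]) : Type := H.

Section Realification.
Variables (R : realType) (H : lmodType R[i]).
Local Notation V := (realification H).

HB.instance Definition _ := GRing.Zmodule.on V.

Definition realification_scale (a : R) (x : V) : V := (a%:C)%C *: (x : H).

Fact realification_scaleA a c (x : V) :
  realification_scale a (realification_scale c x) = realification_scale (a * c) x.
Proof. by rewrite /realification_scale scalerA rmorphM. Qed.

Fact realification_scale1 : left_id 1 realification_scale.
Proof. by move=> x; rewrite /realification_scale rmorph1 scale1r. Qed.

Fact realification_scaleDr : right_distributive realification_scale +%R.
Proof. by move=> a x y; rewrite /realification_scale; exact: scalerDr. Qed.

Fact realification_scaleDl (x : V) :
  {morph realification_scale^~ x : a c / a + c}.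
Proof. by move=> a c; rewrite /realification_scale rmorphD; exact: scalerDl. Qed.

HB.instance Definition _ := GRing.Zmodule_isLmodule.Build R V
  realification_scaleA realification_scale1 realification_scaleDr
  realification_scaleDl.

Variable ip : H -> H -> R[i].
(** Its norm is [hnorm] by unfolding. *)
Definition re_ip (x y : V) : R := complex.Re (ip x y).
Local Notation b := re_ip.

Hypothesis ipH : inner_product_axioms ip.

Lemma ip_conj x y : ip y x = conjc (ip x y).
Proof. by case: ipH. Qed.

Lemma ip_lin a x y z : ip (a *: x + y) z = a * ip x z + ip y z.
Proof. by case: ipH. Qed.

Lemma ipZ a x z : ip (a *: x) z = a * ip x z.
Proof.
have ip0 : ip 0 z = 0.
  have := ip_lin 1 0 0 z; rewrite scale1r addr0 mul1r => /eqP.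
  by rewrite -subr_eq subrr => /eqP <-.
by rewrite -[_ *: x]addr0 ip_lin ip0 addr0.
Qed.

Lemma ReZ (a : R) (z : R[i]) : complex.Re ((a%:C)%C * z) = a * complex.Re z.
Proof. by case: z => x y /=; rewrite mul0r subr0. Qed.

Lemma Re_iM (z : R[i]) : complex.Re ('i%C * z) = - complex.Im z.
Proof. by case: z => x y /=; rewrite mul0r mul1r add0r. Qed.

Lemma re_ip_real : real_ip b.
Proof.
split=> [a x y z|x y|x|x].
- by rewrite /b /re_ip (ip_lin (a%:C)%C x y z) raddfD /= ReZ.
- by rewrite /b ip_conj; case: (ip x y).
- by case: ipH => _ _ /(_ x); rewrite lecE => /andP[].
- case: ipH => _ _ /(_ x) ge0 eq0 x0; apply: eq0; move: ge0 x0; rewrite lecE /b.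
  by case: (ip x x) => r s /= /andP[/eqP -> _] ->.
Qed.

Lemma im_ip (x y : H) : complex.Im (ip x y) = b x ('i%C *: y).
Proof.
rewrite /re_ip (ip_conj (_ *: _) x) ipZ (ip_conj x y).
by case: (ip x y) => r s /=; ring.
Qed.

Lemma im_ip_l (x y : H) : complex.Im (ip x y) = - b ('i%C *: x) y.
Proof. by rewrite /b ipZ Re_iM opprK. Qed.

(** The imaginary part of [ip (u n) y] is the real part of [ip (u n) ('i *: y)], so real parts
    suffice. *)
Lemma weak_to0P (u : nat -> H) :
  weak_to0 ip u <-> forall y, (fun n => b (u n) y) @ \oo --> (0 : R).
Proof.
split=> h y; first by case: (h y).
split; first exact: h.
have -> : (fun n => complex.Im (ip (u n) y)) = (fun n => b (u n) ('i%C *: y)).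
  by apply/funext => n; rewrite im_ip.
exact: h.
Qed.

Section Operator.
Variables (D : set H) (T : H -> H).
Hypothesis saT : selfadjoint ip D T.

(** An adjoint identity between real parts, applied to [x] and to ['i *: x], yields the complex
    identity by linearity of [T]. *)
Lemma re_selfadjoint : rselfadjoint (b : V -> V -> R) (D : set V) (T : V -> V).
Proof.
case: saT => [[D0 lin] dD sym adj]; split.
- split=> // [a x y Dx Dy|a x y Dx Dy|x y Dx Dy].
  + exact: (lin _ x y Dx Dy).1.
  + exact: (lin _ x y Dx Dy).2.
  + by rewrite /b sym.
- by move=> x e /dD-/(_ x)[y [Dy xy]]; exists y.
- move=> y z h; apply: adj; exists z => x Dx.
  have [Dix Tix] := lin 'i%C x 0 Dx D0.
  have T0 : T 0 = 0.
    have := (lin 1 0 0 D0 D0).2; rewrite scaler0 addr0 scale1r => /eqP.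
    by rewrite -subr_eq subrr => /eqP <-.
  rewrite T0 !addr0 in Dix Tix.
  apply/eqP; rewrite eq_complex; apply/andP; split; apply/eqP; first exact: h.
  by rewrite !im_ip_l -Tix h.
Qed.

Lemma Im_quadratic_form x : D x -> complex.Im (ip (T x) x) = 0.
Proof.
case: saT => _ _ sym _ Dx; have := ip_conj (T x) x; rewrite -sym//.
by case: (ip (T x) x) => r s /= [] h; lra.
Qed.

Hypothesis sep : hseparable ip.

(** Symmetry makes the quadratic form real, which gives [Im l = 0]; separability turns the local
    condition into one sequence. *)
Lemma ess_numrangeP l : ess_numrange ip D T l <->
  complex.Im l = 0 /\ local_numrange (b : V -> V -> R) (D : set V) (T : V -> V) (complex.Re l).
Proof.
split=> [[x [Dx x1 /weak_to0P x0 [Tre Tim]]]|[l0 h]].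
  split.
    apply/eqP; rewrite -normr_le0; apply/ler_addgt0Pr => e e0; rewrite add0r.
    have [n0 /(_ _ (leqnn n0))] := (cvgn_dist _ _).1 Tim e e0.
    by rewrite Im_quadratic_form// sub0r normrN => /ltW.
  move=> F e e0; have [n1 h1] := weakly_small_eventually x0 F e0.
  have [n2 h2] := (cvgn_dist _ _).1 Tre e e0.
  exists (x (maxn n1 n2)); split; [exact: Dx|exact: x1|exact: h1 (leq_maxl n1 n2)|].
  exact: h2 (leq_maxr n1 n2).
have [|u [u1 uQ u0]] := @weakly_small_sequence _ V b re_ip_real
  (fun e x => D x /\ `|b (T x) x - complex.Re l| < e) sep.
  by move=> F e e0; have [x [Dx x1 xF hx]] := h F e e0; exists x.
exists u; split=> [n|n||]; [by case: (uQ n)|exact: u1|exact/weak_to0P|split].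
  apply/cvgn_dist => e /harmonic_small[n0 hn0]; exists n0 => n /hn0.
  by apply: lt_trans; case: (uQ n).
have -> : (fun n => complex.Im (ip (T (u n)) (u n))) = (fun=> complex.Im l).
  by apply/funext => n; rewrite l0 Im_quadratic_form//; case: (uQ n).
exact: cvg_cst.
Qed.

Lemma ess_spectrumP r : ess_spectrum ip D T (r%:C)%C <->
  local_spectrum (b : V -> V -> R) (D : set V) (T : V -> V) r.
Proof.
split=> [[x [Dx x1 /weak_to0P x0 hT]] F e e0|h].
  have [n1 h1] := weakly_small_eventually x0 F e0.
  have [n2 h2] := (cvgn_dist _ _).1 hT e e0.
  exists (x (maxn n1 n2)); split; [exact: Dx|exact: x1|exact: h1 (leq_maxl n1 n2)|].
  have := h2 _ (leq_maxr n1 n2); rewrite subr0; exact: le_lt_trans (ler_norm _).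
have [|u [u1 uQ u0]] := @weakly_small_sequence _ V b re_ip_real
  (fun e x => D x /\ ipnorm b (T x - r *: (x : V)) < e) sep.
  by move=> F e e0; have [x [Dx x1 xF hx]] := h F e e0; exists x.
exists u; split=> [n|n||]; [by case: (uQ n)|exact: u1|exact/weak_to0P|].
apply/cvgn_dist => e /harmonic_small[n0 hn0]; exists n0 => n /hn0.
rewrite subr0 ger0_norm ?sqrtr_ge0//.
by apply: lt_trans; case: (uQ n).
Qed.

End Operator.
End Realification.

Lemma econvP (R : realType) (S : set (\bar R)) z :
  econv S z <-> exists x y, [/\ S x, S y, (x <= z)%E & (z <= y)%E].
Proof.
split=> [h|[x [y [Sx Sy xz zy]]] K cK SK]; last exact: cK (SK _ Sx) (SK _ Sy) xz zy.
(* The union of the intervals with endpoints in [S] is itself order convex and contains [S]. *)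
apply: (h [set w | exists x y, [/\ S x, S y, (x <= w)%E & (w <= y)%E]])
  => [x y w [x1 [x2 [? _ x1x _]]] [y1 [y2 [_ ? _ yy2]]] xw wy|x Sx].
  by exists x1, y2; split=> //; [exact: le_trans xw|exact: le_trans yy2].
by exists x, x; split.
Qed.

Theorem theorem3p8 (R : realType) (H : lmodType R[i]) (ip : H -> H -> R[i])
  (hH : separable_inf_hilbert ip) (D : set H) (T : H -> H)
  (hsa : selfadjoint ip D T) (hunb : unbounded_op ip D T) :
  ess_numrange ip D T =
  [set (r%:C)%C | r in [set r : R | econv (ext_ess_spectrum ip D T) r%:E]].
Proof.
have [ipH compl sep inf] := hH.
pose V := realification H; pose b : V -> V -> R := @re_ip R H ip.
have ipb : real_ip b := re_ip_real ipH.
have rsa : rselfadjoint b (D : set V) (T : V -> V) := re_selfadjoint ipH hsa.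
have [symT dD _] := rsa.
have rcompl : rcomplete b.
  move=> u /compl[x hx]; exists x => e e0.
  have [n0 hn0] := (cvgn_dist _ _).1 hx e e0; exists n0 => n /hn0.
  by rewrite subr0; exact: le_lt_trans (ler_norm _).
have rinf : rinfinite_dim b.
  move=> n; have [v hv] := inf n; exists v => i j.
  by rewrite /b /re_ip hv; case: (i == j).
have up : ~ bounded_above ip D T ->
    forall K, exists u : V, [/\ D u, ipnorm b u = 1 & K < b (T u) u].
  move=> nb K; apply: contrapT => h; apply: nb; exists K => u Du u1.
  by rewrite leNgt; apply/negP => Ku; apply: h; exists u.
have low : ~ bounded_below ip D T ->
    forall K, exists u : V, [/\ D u, ipnorm b u = 1 & b (T u) u < K].
  move=> nb K; apply: contrapT => h; apply: nb; exists K => u Du u1.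
  by rewrite leNgt; apply/negP => Ku; apply: h; exists u.
have numP := ess_numrangeP ipH hsa sep.
have specP := @ess_spectrumP _ _ _ ipH D T sep.
apply/seteqP; split=> [l /numP[l0 hl]|_ [r /econvP[x [y [hx hy xr ry]]] <-]].
  exists (complex.Re l); last by case: l l0 {hl} => l1 l2 /= ->.
  apply/econvP.
  have [x [hx xl]] : exists x, ext_ess_spectrum ip D T x /\ (x <= (complex.Re l)%:E)%E.
    have [[m hm]|nb] := pselect (bounded_below ip D T); last first.
      by exists -oo%E; split; [right; right|exact: leNye].
    have [s sl hs] := bottom_essential_spectrum ipb rcompl rsa hm hl.
    by exists s%:E; split; [left; exists s; split=> //; exact/specP|rewrite lee_fin].
  (* The upper endpoint comes from the lower bound result for [- T] at [- Re l]. *)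
  have [y [hy ly]] : exists y, ext_ess_spectrum ip D T y /\ ((complex.Re l)%:E <= y)%E.
    have [[m hm]|nb] := pselect (bounded_above ip D T); last first.
      by exists +oo%E; split; [right; left|exact: leey].
    have [||s sl hs] := bottom_essential_spectrum ipb rcompl
      (selfadjoint_opp ipb rsa) (m := - m) (r := - complex.Re l).
    - by move=> v Dv v1; rewrite (ipNl ipb) lerN2; exact: hm.
    - by apply/(local_numrange_opp ipb); rewrite opprK.
    exists (- s)%:E; split; last by rewrite lee_fin lerNr.
    by left; exists (- s); split=> //; apply/specP/(local_spectrum_opp ipb).
  by exists x, y.
apply/numP; split=> //=.
have num s : ess_spectrum ip D T (s%:C)%C -> local_numrange b (D : set V) (T : V -> V) s.
  by move=> /specP; exact: local_spectrum_numrange.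
move: hx hy xr ry.
(* A lower endpoint [+oo] or an upper endpoint [-oo] contradicts the finiteness of [r], which leaves
   four cases. *)
case=> [[s [-> hs]]|[[-> _]|[-> nbelow]]]; case=> [[t [-> ht]]|[[-> nabove]|[-> _]]] //.
- by rewrite !lee_fin; apply: (local_numrange_convex ipb symT); exact: num.
- by rewrite lee_fin => sr _; exact: local_numrange_up (up nabove) (num _ hs) sr.
(* Lowering from [t] to [r] for [T] is raising from [- t] to [- r] for [- T]. *)
- rewrite lee_fin => _ rt; rewrite -[r]opprK.
  apply/(local_numrange_opp ipb).
  apply: (@local_numrange_up _ _ _ ipb _ _ (symmetric_opp ipb symT) (- t)).
  + by move=> K; have [u [Du u1 hu]] := low nbelow (- K); exists u; rewrite (ipNl ipb) ltrNr.
  + by apply/(local_numrange_opp ipb); rewrite opprK; exact: num.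
  + by rewrite lerN2.
- by move=> _ _; exact: local_numrange_unbounded rinf dD symT (up nabove) (low nbelow).
Qed.
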